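(* Let $p_1,\dots,p_k$ be distinct primes ($k\ge1$) and let $G=S_{p_1}\times S_{p_2}\times\cdots\times S_{p_k}$ be a finite abelian group with $d(G)=2$, where each Sylow $p_i$-subgroup $S_{p_i}$ is non-cyclic and $|S_{p_i}|=p_i^{u_i}$. Then the spectrum of the Laplacian matrix $L$ of $\Gamma(G)$ is $$\mathrm{Spec}(L)=\begin{pmatrix}d-\left((-1)^{|E^-|}\varphi\!\left(\frac{|G|}{p_1p_2\cdots p_k}\right)\prod_{j\in E^+}p_j\right)&d&0\\ \prod_{i\in E^-}p_i&|G|-|\mathcal{I}(G)|-\sigma(p_1p_2\cdots p_k)&|\mathcal{I}(G)|+1\end{pmatrix},$$ where $d$ is the degree of the (regular) graph $\Delta(G)$, and the first column is parametrized over all non-empty subsets $E^-\subseteq\{1,\dots,k\}$ with $E^+=\{1,\dots,k\}\setminus E^-$.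
   Context: The generating graph $\Gamma(G)$ of a group $G$ is the simple graph with vertex set $G$ in which two distinct vertices $x,y$ are adjacent if and only if $\langle x,y\rangle=G$. $\mathcal{I}(G)$ is the set of isolated vertices of $\Gamma(G)$ and $\Delta(G)$ is the subgraph induced by the non-isolated vertices; under these hypotheses $\Delta(G)$ is regular of degree $d=\prod_{i=1}^k p_i\varphi(p_i^{u_i-1})$. $d(G)$ (distinct from the number $d$) is the minimum size of a generating set of $G$. The Laplacian matrix is the diagonal degree matrix minus the adjacency matrix. $\varphi$ is the Euler totient function and $\sigma$ the sum-of-divisors function. In the array for $\mathrm{Spec}$, the first row lists eigenvalues and the second row their multiplicities. Empty products equal $1$. *)

(* Defs.v *)
From HB Require Import structures.
From mathcomp Require Import all_boot all_order all_fingroup all_algebra.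
From mathcomp Require Import all_solvable all_field.

Set Implicit Arguments.
Unset Strict Implicit.
Unset Printing Implicit Defensive.

Import GRing.Theory Num.Theory.
Local Open Scope ring_scope.

Definition sigma (n : nat) : nat := (\sum_(m <- divisors n) m)%N.

(* A finite graph is given by a vertex set [V] in a finite type and an
   adjacency relation [e], only looked at on [V]. Passing to the subgraph
   induced by a subset of the vertices changes [V] and keeps [e]. *)

Section Graphs.

Variables (T : finType) (V : {set T}) (e : rel T).

Definition degree (x : T) : nat := #|[set y in V | e x y]|.

Definition isolated : {set T} := [set x in V | [forall y in V, ~~ e x y]].

Definition regular (r : nat) : Prop := {in V, forall x, degree x = r}.

Definition adjacency_mx : 'M[algC]_#|V| :=
  \matrix_(i, j) (e (enum_val i) (enum_val j))%:R.

Definition degree_mx : 'M[algC]_#|V| :=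
  diag_mx (\row_i (degree (enum_val i))%:R).

Definition laplacian_mx : 'M[algC]_#|V| := degree_mx - adjacency_mx.

End Graphs.

Definition gen_adj (gT : finGroupType) (G : {set gT}) : rel gT :=
  [rel x y | (x != y) && (<<[set x; y]>>%g == G)].

Definition gen_isolated (gT : finGroupType) (G : {set gT}) : {set gT} :=
  isolated G (gen_adj G).

(* The roots of the characteristic polynomial with multiplicity; the order is
   unspecified. *)
Definition spectrum (n : nat) (A : 'M[algC]_n) : seq algC :=
  sval (closed_field_poly_normal (char_poly A)).

(* [cols] lists the columns (eigenvalue, multiplicity) of the array. The first
   components are distinct, so the second one is the full multiplicity; it may
   be 0, in which case the column contributes nothing to the spectrum. *)
Definition spectrum_array (n : nat) (A : 'M[algC]_n)
    (cols : seq (algC * nat)) : Prop :=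
  uniq [seq c.1 | c <- cols] /\
  perm_eq (spectrum A) (flatten [seq nseq c.2 c.1 | c <- cols]).

(* Main.v *)
Require Import Defs.
From HB Require Import structures.
From mathcomp Require Import all_boot all_order all_fingroup all_algebra.
From mathcomp Require Import all_solvable all_field.
From mathcomp Require Import ring.

Set Implicit Arguments.
Unset Strict Implicit.
Unset Printing Implicit Defensive.

Import GRing.Theory Num.Theory.
Local Open Scope ring_scope.

(* For each [i], call the subgroups <x>Phi(S_i) with x in W_i = S_i \ Phi(S_i)
   the lines of S_i: there are p_i + 1 of them, they meet W_i in m_i elements
   each, and two elements generate S_i iff they lie in W_i and on distinct
   lines. Hence x and y generate G iff all their p_i-parts lie in W_i on
   distinct lines, so the adjacency matrix of the generating graph is the
   tensor product of the kernels J_i - R_i on the S_i, where J_i is 1 on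
   W_i x W_i and R_i is the relation "same line". Now
   J_i - R_i = p_i m_i (J_i / n_i) - m_i (R_i / m_i - J_i / n_i) with
   n_i = (p_i + 1) m_i = |W_i|, and the two kernels in parentheses are
   orthogonal idempotents of traces 1 and p_i. Expanding the tensor product
   gives orthogonal idempotents indexed by the subsets E of indices at which
   the second kernel is chosen, of rank the product of the p_i with i in E. *)

(** * Orthogonal idempotents *)

(** Sylvester's identity: both sides of [eM] are products of block triangular matrices, and on each
    side all diagonal blocks but one are identities. *)
Lemma det_1DmulmxC (R : comNzRingType) m n (A : 'M[R]_(m, n))
    (B : 'M[R]_(n, m)) :
  \det (1%:M + A *m B) = \det (1%:M + B *m A).
Proof.
have eM : block_mx (1%:M + A *m B) (- A) 0 1%:M *m block_mx 1%:M 0 B 1%:M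
    = block_mx 1%:M 0 B 1%:M *m block_mx 1%:M (- A) 0 (1%:M + B *m A).
  rewrite !mulmx_block !mulmx1 !mul1mx !mul0mx !mulmx0 !mulNmx !mulmxN.
  by rewrite !addr0 !add0r addrK [- _ + _]addrC addrK.
move/(congr1 determinant): eM.
by rewrite !det_mulmx !det_ublock !det_lblock !det1 !mul1r !mulr1.
Qed.

(** Write [P = C R] with [C] of full column rank and [R] of full row rank; then [C R C R = C R]
    cancels to [R C = 1]. *)
Lemma rank_factor_idempotent (F : fieldType) n (P : 'M[F]_n) :
  P *m P = P -> row_base P *m col_base P = 1%:M.
Proof.
move=> PP; apply: (row_full_inj (col_base_full P)).
apply: (row_free_inj (row_base_free P)) => /=.
rewrite mulmx1 [RHS]mulmx_base.
transitivity (col_base P *m row_base P *m (col_base P *m row_base P)).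
  by rewrite !mulmxA.
by rewrite mulmx_base.
Qed.

Lemma mxtrace_idempotent (F : fieldType) n (P : 'M[F]_n) :
  P *m P = P -> \tr P = (\rank P)%:R.
Proof.
move=> PP; rewrite -{1}(mulmx_base P) mxtrace_mulC.
by rewrite rank_factor_idempotent // mxtrace1.
Qed.

(** Sylvester's identity moves the determinant to the scalar matrix [1 + t] of size [\rank P]. *)
Lemma det_1D_idempotent (F : fieldType) n (P : 'M[F]_n) (t : {poly F}) :
  P *m P = P -> \det (1%:M + t *: map_mx polyC P) = (1 + t) ^+ \rank P.
Proof.
move=> PP; rewrite -{1}(mulmx_base P) map_mxM scalemxAl det_1DmulmxC.
rewrite -scalemxAr -map_mxM rank_factor_idempotent // map_mx1.
by rewrite scalemx1 -raddfD det_scalar.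
Qed.

(** By orthogonality the product of the matrices [1 + t i Q i] has no cross terms. *)
Lemma det_1D_sum_orthogonal (R : comNzRingType) n (I : eqType) (s : seq I)
    (t : I -> R) (Q : I -> 'M[R]_n) :
  uniq s -> (forall i j, i != j -> Q i *m Q j = 0) ->
  \det (1%:M + \sum_(i <- s) t i *: Q i)
    = \prod_(i <- s) \det (1%:M + t i *: Q i).
Proof.
move=> + QQ; elim: s => [|i s IH] /=; first by rewrite !big_nil addr0 det1.
case/andP=> is_ us; rewrite !big_cons -IH // -det_mulmx; congr (\det _).
rewrite mulmxDr mulmx1 mulmxDl mul1mx mulmx_sumr addrA.
rewrite [X in _ + _ + (_ + X)]big1_seq ?addr0 // => j /andP[_ js].
rewrite -scalemxAl -scalemxAr QQ ?scaler0 //.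
by apply: contraNneq is_ => ->.
Qed.

(** As the [P i] sum to 1, the characteristic matrix is [1 + \sum_i (X - a i - 1) P i], to which the
    two preceding determinant formulas apply. *)
Lemma char_poly_orthogonal (F : fieldType) n (I : finType)
    (P : I -> 'M[F]_n) (a : I -> F) :
  (forall i, P i *m P i = P i) -> (forall i j, i != j -> P i *m P j = 0) ->
  \sum_i P i = 1%:M ->
  char_poly (\sum_i a i *: P i) = \prod_i ('X - (a i)%:P) ^+ \rank (P i).
Proof.
move=> PP PQ P1.
have P1' : \sum_i map_mx polyC (P i) = 1%:M :> 'M[{poly F}]_n.
  by rewrite -(map_mx1 (polyC : {rmorphism F -> {poly F}})) -P1 map_mx_sum.
have -> : char_poly (\sum_i a i *: P i)
    = \det (1%:M + \sum_i ('X - (a i)%:P - 1) *: map_mx polyC (P i)).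
  congr (\det _); rewrite /char_poly_mx -['X%:M]scalemx1 -P1' map_mx_sum.
  rewrite scaler_sumr.
  rewrite -sumrB -big_split; apply: eq_bigr => i _ /=.
  by rewrite map_mxZ !scalerBl scale1r [RHS]addrC subrK.
rewrite det_1D_sum_orthogonal ?index_enum_uniq //; last first.
  by move=> i j /PQ PQij; rewrite -map_mxM PQij map_mx0.
apply: eq_bigr => i _; rewrite det_1D_idempotent //.
by rewrite addrC subrK.
Qed.

(** * Tensor products of kernels *)

Section TensorKernel.

Variables (F : fieldType) (T U I : finType) (V : {set T}) (S : I -> {set U}).
Variable c : I -> T -> U.

(** Under [sum_coord] this behaves as the Kronecker product of kernels on the [S i], but is indexed
    directly by the vertices in [V]. *)
Definition tensor_kernel (a : I -> U -> U -> F) : 'M[F]_#|V| :=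
  \matrix_(x, y) \prod_i a i (c i (enum_val x)) (c i (enum_val y)).

Lemma eq_tensor_kernel (a b : I -> U -> U -> F) :
  (forall i x y, a i x y = b i x y) -> tensor_kernel a = tensor_kernel b.
Proof. by move=> ab; apply/matrixP => x y; rewrite !mxE; apply: eq_bigr. Qed.

Lemma tensor_kernelD (a b : I -> U -> U -> F) :
  tensor_kernel (fun i x y => a i x y + b i x y)
    = \sum_(E : {set I})
        tensor_kernel (fun i x y => if i \in E then a i x y else b i x y).
Proof.
apply/matrixP => x y; rewrite mxE summxE bigA_distr.
by apply: eq_bigr => E _; rewrite mxE.
Qed.

Lemma tensor_kernelZ (s : I -> F) (a : I -> U -> U -> F) :
  tensor_kernel (fun i x y => s i * a i x y)
    = (\prod_i s i) *: tensor_kernel a.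
Proof. by apply/matrixP => x y; rewrite !mxE big_split. Qed.

Lemma tensor_kernel0 i0 (a : I -> U -> U -> F) :
  (forall x y, a i0 x y = 0) -> tensor_kernel a = 0.
Proof.
by move=> a0; apply/matrixP => x y; rewrite !mxE (bigD1 i0) //= a0 mul0r.
Qed.

Hypothesis sum_coord : forall g : I -> U -> F,
  \sum_(x in V) \prod_i g i (c i x) = \prod_i \sum_(z in S i) g i z.

(** The sum over the middle vertex factors into sums over the coordinates. *)
Lemma tensor_kernelM (a b : I -> U -> U -> F) :
  tensor_kernel a *m tensor_kernel b
    = tensor_kernel (fun i x y => \sum_(z in S i) a i x z * b i z y).
Proof.
apply/matrixP => x y; rewrite !mxE.
rewrite -(sum_coord (fun i z => a i (c i (enum_val x)) z *
                                b i z (c i (enum_val y)))).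
by rewrite [RHS]big_enum_val; apply: eq_bigr => z _; rewrite !mxE big_split.
Qed.

Lemma mxtrace_tensor_kernel (a : I -> U -> U -> F) :
  \tr (tensor_kernel a) = \prod_i \sum_(z in S i) a i z z.
Proof.
rewrite -(sum_coord (fun i z => a i z z)) [RHS]big_enum_val.
by apply: eq_bigr => x _; rewrite mxE.
Qed.

End TensorKernel.

(** * One block: the algebra of the constant and fibre kernels *)

Section BlockKernels.

Variables (F : numFieldType) (U Q : finType) (S W : {set U}) (l : U -> Q).
Variables (q m : nat).
Hypothesis WS : W \subset S.
Hypothesis m_gt0 : (0 < m)%N.
Hypothesis cardW : #|W| = (q.+1 * m)%N.
Hypothesis card_fibre : {in W, forall x, #|[set y in W | l x == l y]| = m}.

Definition delta_ker (x y : U) : F := [&& x \in W, y \in W & x == y]%:R.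

Definition fibre_ker (x y : U) : F := [&& x \in W, y \in W & l x == l y]%:R.

Definition const_ker (x y : U) : F := [&& x \in W & y \in W]%:R.

Definition const_proj (x y : U) : F := const_ker x y / (q.+1 * m)%:R.

(** The projection onto the functions on [W] that are constant on fibres and have sum zero; as there
    are [q + 1] fibres, its rank is [q]. *)
Definition fibre_proj (x y : U) : F := fibre_ker x y / m%:R - const_proj x y.

(** The left side is the adjacency kernel of the complete multipartite graph on the fibres, with
    eigenvalue [q * m] on constants and [- m] on the range of [fibre_proj]. *)
Lemma block_ker_split x y :
  const_ker x y - fibre_ker x y
    = - m%:R * fibre_proj x y + (q * m)%:R * const_proj x y.
Proof.
have m0 : m%:R != 0 :> F by rewrite pnatr_eq0 -lt0n.
have q0 : q.+1%:R != 0 :> F by rewrite pnatr_eq0.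
by rewrite /fibre_proj /const_proj; field; rewrite m0 nat1r.
Qed.

Let sum_indicator (A : {set U}) (t : F) :
  A \subset W -> \sum_(z in S) t * (z \in A)%:R = t * #|A|%:R.
Proof.
move=> AW; rewrite -mulr_sumr -natr_sum; congr (_ * _%:R).
rewrite -big_mkcondr -sum1_card /=; apply: eq_bigl => z.
by apply: andb_idl => /(subsetP AW)/(subsetP WS).
Qed.

Let fibre_sub x : [set y in W | l x == l y] \subset W.
Proof. by apply/subsetP => y; rewrite inE => /andP[]. Qed.

(** This and the next three lemmas form the multiplication table of the two kernels, obtained by
    counting the [z] that make both factors 1. *)
Lemma sum_const_const x y :
  \sum_(z in S) const_ker x z * const_ker z y = const_ker x y * (q.+1 * m)%:R.
Proof.
rewrite -cardW -sum_indicator //; apply: eq_bigr => z _.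
by rewrite /const_ker -!natrM !mulnb; case: (z \in W); rewrite ?andbT ?andbF.
Qed.

Lemma sum_const_fibre x y :
  \sum_(z in S) const_ker x z * fibre_ker z y = const_ker x y * m%:R.
Proof.
have [yW|yW] := boolP (y \in W); last first.
  rewrite /const_ker /fibre_ker (negPf yW) andbF mul0r big1 // => z _.
  by rewrite andbF mulr0.
rewrite -(card_fibre yW) -sum_indicator //; apply: eq_bigr => z _.
rewrite /const_ker /fibre_ker inE -!natrM !mulnb yW eq_sym.
by case: (z \in W); rewrite ?andbT ?andbF.
Qed.

Lemma sum_fibre_const x y :
  \sum_(z in S) fibre_ker x z * const_ker z y = const_ker x y * m%:R.
Proof.
have [xW|xW] := boolP (x \in W); last first.
  rewrite /const_ker /fibre_ker (negPf xW) mul0r big1 // => z _.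
  by rewrite mul0r.
rewrite -(card_fibre xW) -sum_indicator //; apply: eq_bigr => z _.
rewrite /const_ker /fibre_ker inE -!natrM !mulnb xW andbC.
by case: (z \in W); rewrite ?andbT ?andbF.
Qed.

Lemma sum_fibre_fibre x y :
  \sum_(z in S) fibre_ker x z * fibre_ker z y = fibre_ker x y * m%:R.
Proof.
have [xW|xW] := boolP (x \in W); last first.
  rewrite /fibre_ker (negPf xW) mul0r big1 // => z _.
  by rewrite mul0r.
rewrite -(card_fibre xW) -sum_indicator //; apply: eq_bigr => z _.
rewrite /fibre_ker inE -!natrM !mulnb xW.
case: (z \in W); rewrite ?andbT ?andbF //=.
by have [->|] := eqVneq (l x) (l z); rewrite ?andbT ?andbF //=.
Qed.

(** With [s] and [t] the inverses of [m] and [q.+1 * m], this reduces the square of [fibre_proj] to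
    the multiplication table. *)
Let sum_bilinear (X1 X2 Y1 Y2 : U -> U -> F) (s t : F) x y :
  \sum_(z in S) (X1 x z * s - X2 x z * t) * (Y1 z y * s - Y2 z y * t)
    = (\sum_(z in S) X1 x z * Y1 z y) * s ^+ 2
      - (\sum_(z in S) X1 x z * Y2 z y) * (s * t)
      - (\sum_(z in S) X2 x z * Y1 z y) * (s * t)
      + (\sum_(z in S) X2 x z * Y2 z y) * t ^+ 2.
Proof.
rewrite !mulr_suml -!sumrB -big_split; apply: eq_bigr => z _ /=.
by ring.
Qed.

Let m0 : m%:R != 0 :> F. Proof. by rewrite pnatr_eq0 -lt0n. Qed.
Let n0 : (q.+1 * m)%:R != 0 :> F.
Proof. by rewrite pnatr_eq0 -lt0n muln_gt0. Qed.

Lemma fibre_proj_idem x y :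
  \sum_(z in S) fibre_proj x z * fibre_proj z y = fibre_proj x y.
Proof.
rewrite sum_bilinear sum_const_const sum_const_fibre sum_fibre_const.
rewrite sum_fibre_fibre /fibre_proj /const_proj.
by field; rewrite m0 nat1r pnatr_eq0.
Qed.

Lemma const_proj_idem x y :
  \sum_(z in S) const_proj x z * const_proj z y = const_proj x y.
Proof.
under eq_bigr do rewrite mulrACA.
by rewrite -mulr_suml sum_const_const mulrA mulfK.
Qed.

Lemma fibre_const_proj x y :
  \sum_(z in S) fibre_proj x z * const_proj z y = 0.
Proof.
under eq_bigr do rewrite mulrBl mulrACA [X in _ - X]mulrACA.
rewrite sumrB -!mulr_suml sum_const_const sum_fibre_const.
by apply/eqP; rewrite subr_eq0; apply/eqP; field; rewrite m0 nat1r pnatr_eq0.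
Qed.

Lemma const_fibre_proj x y :
  \sum_(z in S) const_proj x z * fibre_proj z y = 0.
Proof.
under eq_bigr do rewrite mulrBr mulrACA [X in _ - X]mulrACA.
rewrite sumrB -!mulr_suml sum_const_const sum_const_fibre.
by apply/eqP; rewrite subr_eq0; apply/eqP; field; rewrite m0 nat1r pnatr_eq0.
Qed.

Lemma trace_const_proj : \sum_(z in S) const_proj z z = 1.
Proof.
rewrite -mulr_suml; under eq_bigr do rewrite /const_ker andbb -[_%:R]mul1r.
by rewrite sum_indicator // mul1r cardW divff.
Qed.

Lemma trace_fibre_proj : \sum_(z in S) fibre_proj z z = q%:R.
Proof.
rewrite sumrB trace_const_proj -mulr_suml.
under eq_bigr do rewrite /fibre_ker eqxx andbT andbb -[_%:R]mul1r.
by rewrite sum_indicator // mul1r cardW natrM mulfK // -natr1 addrK.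
Qed.

(** The support condition makes up for [delta_ker] being the identity on [W] only. *)
Lemma delta_kerl (X : U -> U -> F) x y :
  (forall a b, ~~ ((a \in W) && (b \in W)) -> X a b = 0) ->
  \sum_(z in S) delta_ker x z * X z y = X x y.
Proof.
move=> X0; have [xW|xW] := boolP (x \in W); last first.
  rewrite X0 ?(negPf xW) // big1 // => z _.
  by rewrite /delta_ker (negPf xW) mul0r.
rewrite (bigD1 x) ?(subsetP WS) //= /delta_ker xW eqxx mul1r big1 ?addr0 //.
by move=> z /andP[_]; rewrite eq_sym => /negPf->; rewrite andbF mul0r.
Qed.

Lemma delta_kerr (X : U -> U -> F) x y :
  (forall a b, ~~ ((a \in W) && (b \in W)) -> X a b = 0) ->
  \sum_(z in S) X x z * delta_ker z y = X x y.
Proof.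
move=> X0; have [yW|yW] := boolP (y \in W); last first.
  rewrite X0 ?(negPf yW) ?andbF // big1 // => z _.
  by rewrite /delta_ker (negPf yW) andbF mulr0.
rewrite (bigD1 y) ?(subsetP WS) //= /delta_ker yW eqxx mulr1 big1 ?addr0 //.
by move=> z /andP[_] /negPf->; rewrite !andbF mulr0.
Qed.

Lemma delta_ker_supp a b :
  ~~ ((a \in W) && (b \in W)) -> delta_ker a b = 0.
Proof. by rewrite /delta_ker andbA => /negPf->. Qed.

Lemma const_proj_supp a b :
  ~~ ((a \in W) && (b \in W)) -> const_proj a b = 0.
Proof. by rewrite /const_proj /const_ker => /negPf->; rewrite mul0r. Qed.

Lemma fibre_proj_supp a b :
  ~~ ((a \in W) && (b \in W)) -> fibre_proj a b = 0.
Proof.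
move=> ab; rewrite /fibre_proj const_proj_supp // /fibre_ker andbA (negPf ab).
by rewrite mul0r subr0.
Qed.

(** A point of [W] is joined to all of [W] except its own fibre. *)
Lemma row_sum_block_ker x :
  \sum_(z in S) (const_ker x z - fibre_ker x z)
    = ((x \in W) * (q * m))%:R.
Proof.
have [xW|xW] := boolP (x \in W); last first.
  by rewrite big1 // => z _; rewrite /const_ker /fibre_ker (negPf xW) subr0.
rewrite sumrB; under eq_bigr do rewrite /const_ker xW -[_%:R]mul1r.
have -> : \sum_(z in S) fibre_ker x z
    = \sum_(z in S) 1 * (z \in [set y in W | l x == l y])%:R.
  by apply: eq_bigr => z _; rewrite inE mul1r /fibre_ker xW.
rewrite !sum_indicator // card_fibre // cardW !mul1r mul1n.
by rewrite mulSn natrD addrC addKr.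
Qed.

End BlockKernels.

(** * Graphs that are tensor products of blocks *)

Section BlockProductGraph.

Variables (T U Q I : finType) (V : {set T}) (S W : I -> {set U}).
Variables (c : I -> T -> U) (l : I -> U -> Q) (q m : I -> nat) (e : rel T).
Hypothesis sum_coord : forall g : I -> U -> algC,
  \sum_(x in V) \prod_i g i (c i x) = \prod_i \sum_(z in S i) g i z.
Hypothesis coord_inj :
  {in V &, forall x y, (forall i, c i x = c i y) -> x = y}.
Hypothesis WS : forall i, W i \subset S i.
Hypothesis m_gt0 : forall i, (0 < m i)%N.
Hypothesis q_gt0 : forall i, (0 < q i)%N.
Hypothesis cardW : forall i, #|W i| = ((q i).+1 * m i)%N.
Hypothesis card_fibre : forall i,
  {in W i, forall x, #|[set y in W i | l i x == l i y]| = m i}.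
Hypothesis eE : {in V &, forall x y, e x y =
  [forall i, [&& c i x \in W i, c i y \in W i & l i (c i x) != l i (c i y)]]}.

(** [N] will turn out to be the set of non-isolated vertices, [d] their common degree, and
    [lambda E] the adjacency eigenvalue on the range of [P E]. *)
Let d := (\prod_i (q i * m i))%N.
Let N := [set x in V | [forall i, c i x \in W i]].
Let lambda (E : {set I}) : algC :=
  \prod_i (if i \in E then - (m i)%:R else (q i * m i)%:R).

(** Each factor is 0 or 1, so the conjunction over the coordinates becomes a product. *)
Let edge_prod : {in V &, forall x y, (e x y)%:R = \prod_i
  (const_ker algC (W i) (c i x) (c i y)
   - fibre_ker algC (W i) (l i) (c i x) (c i y))}.
Proof.
move=> x y xV yV; rewrite eE //.
have [/forallP exy|/forallPn[i nexy]] := boolP [forall i,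
  [&& c i x \in W i, c i y \in W i & l i (c i x) != l i (c i y)]].
  rewrite big1 // => i _; have /and3P[xW yW lxy] := exy i.
  by rewrite /const_ker /fibre_ker xW yW (negPf lxy) subr0.
rewrite (bigD1 i) //=; suff ->: const_ker algC (W i) (c i x) (c i y)
   - fibre_ker algC (W i) (l i) (c i x) (c i y) = 0 by rewrite mul0r.
move: nexy; rewrite /const_ker /fibre_ker.
case: (_ \in _); case: (_ \in _); case: (_ == _) => //= _; exact: subrr.
Qed.

Lemma block_product_degree :
  {in V, forall x, degree V e x = ((x \in N) * d)%N}.
Proof.
(* Over [algC] the degree is a row sum of the adjacency kernel, which [sum_coord] splits into row
   sums of the blocks. *)
move=> x xV; apply/eqP; rewrite -(eqr_nat algC); apply/eqP.
rewrite /degree -sum1_card natr_sum.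
under eq_bigl do rewrite inE; rewrite big_mkcondr /=.
under eq_bigr => y yV do rewrite -mulrb mulr1n edge_prod //.
rewrite (sum_coord (fun i z => const_ker algC (W i) (c i x) z
   - fibre_ker algC (W i) (l i) (c i x) z)).
under eq_bigr => i _ do
  rewrite (row_sum_block_ker _ (WS i) (cardW i) (@card_fibre i)).
rewrite -natr_prod inE xV /= /d; congr _%:R.
have [/forallP xW|/forallPn[i xW]] := boolP [forall i, c i x \in W i].
  by rewrite mul1n; apply: eq_bigr => i _; rewrite xW mul1n.
by rewrite (bigD1 i) //= (negPf xW).
Qed.

(** Since [d] is positive, the degree vanishes exactly off [N]. *)
Lemma block_product_isolated : isolated V e = V :\: N.
Proof.
apply/setP => x; rewrite !inE.
have [xV|//] /= := boolP (x \in V).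
have d_gt0 : (0 < d)%N.
  by rewrite prodn_gt0 // => i; rewrite muln_gt0 q_gt0 m_gt0.
have := block_product_degree xV; rewrite inE xV /= andbT.
case: [forall i, c i x \in W i] => /=; rewrite ?mul1n ?mul0n => degx.
  have /card_gt0P[y] : (0 < degree V e x)%N by rewrite degx.
  rewrite inE => /andP[yV exy]; apply/negbTE/forallPn; exists y.
  by rewrite yV exy.
apply/forallP => y; apply/implyP => yV.
by have := card0_eq degx y; rewrite inE yV /= => ->.
Qed.

Let P (E : {set I}) : 'M[algC]_#|V| := tensor_kernel V c
  (fun i x y => if i \in E then fibre_proj algC (W i) (l i) (q i) (m i) x y
                else const_proj algC (W i) (q i) (m i) x y).
Let D : 'M[algC]_#|V| := tensor_kernel V c (fun i => delta_ker algC (W i)).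

Let PP E : P E *m P E = P E.
Proof.
rewrite /P (tensor_kernelM sum_coord); apply: eq_tensor_kernel => i x y.
case: ifP => _.
  exact: (fibre_proj_idem _ (WS i) (m_gt0 i) (cardW i) (@card_fibre i)).
exact: (const_proj_idem _ (WS i) (m_gt0 i) (cardW i)).
Qed.

(** At an index where the subsets differ, [fibre_proj] meets [const_proj], and one zero factor
    annihilates the tensor product. *)
Let PQ E E' : E != E' -> P E *m P E' = 0.
Proof.
rewrite eqEsubset negb_and => EE'; rewrite /P (tensor_kernelM sum_coord).
case/orP: EE' => /subsetPn[i iE iE'].
  apply: (@tensor_kernel0 _ _ _ _ _ _ i) => x y; rewrite iE (negPf iE').
  exact: (fibre_const_proj _ (WS i) (m_gt0 i) (cardW i) (@card_fibre i)).
apply: (@tensor_kernel0 _ _ _ _ _ _ i) => x y; rewrite iE (negPf iE').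
exact: (const_fibre_proj _ (WS i) (m_gt0 i) (cardW i) (@card_fibre i)).
Qed.

Let DD : D *m D = D.
Proof.
rewrite /D (tensor_kernelM sum_coord); apply: eq_tensor_kernel => i x y.
apply: (delta_kerl (WS i)); exact: delta_ker_supp.
Qed.

Let DP E : D *m P E = P E.
Proof.
rewrite /D (tensor_kernelM sum_coord); apply: eq_tensor_kernel => i x y.
by case: ifP => _; apply: (delta_kerl (WS i)) => a b ab;
  [apply: fibre_proj_supp | apply: const_proj_supp].
Qed.

Let PD E : P E *m D = P E.
Proof.
rewrite /D (tensor_kernelM sum_coord); apply: eq_tensor_kernel => i x y.
by case: ifP => _; apply: (delta_kerr (WS i)) => a b ab;
  [apply: fibre_proj_supp | apply: const_proj_supp].
Qed.

Let trP E : \tr (P E) = (\prod_(i in E) q i)%:R.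
Proof.
rewrite /P (mxtrace_tensor_kernel sum_coord) natr_prod [RHS]big_mkcond.
apply: eq_bigr => i _; case: ifP => _.
  exact: (trace_fibre_proj algC (l i) (WS i) (m_gt0 i) (cardW i)).
exact: (trace_const_proj algC (WS i) (m_gt0 i) (cardW i)).
Qed.

(** By [coord_inj] distinct vertices differ in some coordinate, whose delta factor kills the
    off-diagonal entry. *)
Let DE x y : D x y = ((x == y) && (enum_val x \in N))%:R.
Proof.
rewrite mxE inE enum_valP /=.
have [->|xy] := eqVneq x y.
  have [/forallP yW|/forallPn[i yW]] :=
    boolP [forall i, c i (enum_val y) \in W i].
    by rewrite big1 // => i _; rewrite /delta_ker !yW eqxx.
  by rewrite (bigD1 i) //= /delta_ker (negPf yW) mul0r.
have /existsP[i cxy] : [exists i, c i (enum_val x) != c i (enum_val y)].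
  apply: contra_neqT xy; rewrite negb_exists => /forallP cxy.
  apply/enum_val_inj/coord_inj; rewrite ?enum_valP // => i.
  by apply/eqP; rewrite -[_ == _]negbK.
by rewrite (bigD1 i) //= /delta_ker (negPf cxy) !andbF mul0r.
Qed.

Let trD : \tr D = #|N|%:R.
Proof.
rewrite /mxtrace; under eq_bigr do rewrite DE eqxx /=.
rewrite -(big_enum_val (fun x => (x \in N)%:R)) /= -natr_sum; congr _%:R.
rewrite -big_mkcondr -sum1_card; apply: eq_bigl => x.
by rewrite inE andbA andbb.
Qed.

Let adjacencyE : adjacency_mx V e = \sum_E lambda E *: P E.
Proof.
transitivity (tensor_kernel V c (fun i x y =>
    - (m i)%:R * fibre_proj algC (W i) (l i) (q i) (m i) x y
    + (q i * m i)%:R * const_proj algC (W i) (q i) (m i) x y)).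
  apply/matrixP => x y; rewrite !mxE edge_prod ?enum_valP //.
  by apply: eq_bigr => i _; apply: block_ker_split.
rewrite tensor_kernelD; apply: eq_bigr => E _.
rewrite -tensor_kernelZ; apply: eq_tensor_kernel => i x y.
by case: ifP.
Qed.

Let degreeE : degree_mx V e = d%:R *: D.
Proof.
apply/matrixP => x y; rewrite [RHS]mxE DE [LHS]mxE [X in X *+ _]mxE.
rewrite block_product_degree ?enum_valP //.
case: (x == y) => /=; last by rewrite mulr0.
by rewrite mulr1n mulnC natrM.
Qed.

Lemma char_poly_block_product :
  char_poly (laplacian_mx V e)
    = (\prod_E ('X - (d%:R - lambda E)%:P) ^+ (\prod_(i in E) q i)%N)
      * ('X - d%:R%:P) ^+ (#|N| - \prod_i (q i).+1) * 'X ^+ #|V :\: N|.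
Proof.
(* The [P E] are completed to a resolution of the identity: [inr true] covers the rest of the
   functions supported on [N], [inr false] those supported off [N]. The Laplacian eigenvalues are
   listed by [a]. *)
pose Pc (z : {set I} + bool) : 'M[algC]_#|V| := match z with
  | inl E => P E
  | inr b => if b then D - \sum_E P E else 1%:M - D end.
pose a (z : {set I} + bool) : algC := match z with
  | inl E => d%:R - lambda E
  | inr b => if b then d%:R else 0 end.
have DsP : D *m (\sum_E P E) = \sum_E P E.
  by rewrite mulmx_sumr; apply: eq_bigr => E _.
have sPD : (\sum_E P E) *m D = \sum_E P E.
  by rewrite mulmx_suml; apply: eq_bigr => E _.
have sPP E : (\sum_E P E) *m P E = P E.
  by rewrite mulmx_suml (bigD1 E) //= big1 ?addr0 // => E'; apply: PQ.
have PsP E : P E *m (\sum_E P E) = P E.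
  rewrite mulmx_sumr (bigD1 E) //= big1 ?addr0 // => E'; rewrite eq_sym.
  exact: PQ.
have sPsP : (\sum_E P E) *m (\sum_E P E) = \sum_E P E.
  by rewrite mulmx_sumr; apply: eq_bigr => E _.
have PcPc z : Pc z *m Pc z = Pc z.
  case: z => [E|[]] //=.
    by rewrite mulmxBl !mulmxBr DD DsP sPD sPsP subrr subr0.
  by rewrite mulmxBl !mulmxBr !mul1mx mulmx1 DD subrr subr0.
have PcPc' z w : z != w -> Pc z *m Pc w = 0.
  case: z w => [E|[]] [E'|[]] //= zw; rewrite ?mulmxBl ?mulmxBr ?mulmx1 ?mul1mx.
  - by apply: PQ; apply: contraNneq zw => ->.
  - by rewrite PD PsP subrr.
  - by rewrite PD subrr.
  - by rewrite DP sPP subrr.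
  - by rewrite DD sPD !subrr.
  - by rewrite DP subrr.
  - by rewrite DD DsP !subrr.
(* Expanding the product yields the total rank of the [P E]. *)
have sigmaE : (\prod_i (q i).+1 = \sum_(E : {set I}) \prod_(i in E) q i)%N.
  under eq_bigr do rewrite -addn1.
  by rewrite bigA_distr; apply: eq_bigr => E _; rewrite [RHS]big_mkcond.
have NV : N \subset V by apply/subsetP => x; rewrite inE => /andP[].
have Pc1 : \sum_z Pc z = 1%:M.
  by rewrite big_sumType big_bool /= addrA [X in X + _]addrC !subrK addrC subrK.
have -> : laplacian_mx V e = \sum_z a z *: Pc z.
  rewrite big_sumType big_bool /= scale0r addr0 /laplacian_mx adjacencyE.
  rewrite degreeE.
  under [X in _ = X + _]eq_bigr do rewrite scalerBl.
  rewrite sumrB -scaler_sumr scalerBr.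
  by rewrite [RHS]addrC addrA subrK.
rewrite char_poly_orthogonal // big_sumType big_bool /= mulrA.
have rankE z n : \tr (Pc z) = n%:R -> \rank (Pc z) = n.
  by rewrite mxtrace_idempotent // => /eqP; rewrite eqr_nat => /eqP.
congr (_ * _ * _).
- by apply: eq_bigr => E _; rewrite (rankE (inl E) _ (trP E)).
(* The truncated subtraction is exact: the rank plus the product is shown to be [#|N|]. *)
- have rankD : \rank (Pc (inr true)) = (#|N| - \prod_i (q i).+1)%N.
    rewrite -(addnK (\prod_i (q i).+1) (\rank _)); congr (_ - _)%N.
    apply/eqP; rewrite -(eqr_nat algC) natrD -mxtrace_idempotent // raddfB /=.
    rewrite trD (raddf_sum mxtrace) /=.
    under eq_bigr do rewrite trP.
    by rewrite -natr_sum -sigmaE subrK.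
  by rewrite -rankD.
- rewrite subr0; congr (_ ^+ _); apply: (rankE (inr false)) => /=.
  rewrite raddfB /= mxtrace1 trD -natrB ?subset_leq_card //.
  by rewrite cardsD (setIidPr _).
Qed.

End BlockProductGraph.
(** * Generating pairs in abelian groups *)

Section FrattiniLines.

Local Open Scope group_scope.

Variables (gT : finGroupType) (p : nat) (S : {group gT}).
Hypotheses (p_pr : prime p) (pS : p.-group S) (cSS : abelian S).
Hypothesis rankS2 : 'r(S) = 2.

(* The lines of the plane [S / 'Phi(S)], pulled back to [S]. *)
Definition frattini_line (x : gT) : {set gT} := <[x]> <*> 'Phi(S).

(** In an abelian p-group the Frattini subgroup consists of the p-th powers, so its index is the
    order [p ^ 2] of ['Ohm_1(S)]. *)
Lemma card_Phi_rank2 : (p ^ 2 * #|'Phi(S)|)%N = #|S|.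
Proof.
rewrite (Phi_Mho pS cSS) -(mul_card_Ohm_Mho_abelian 1 cSS); congr (_ * _)%N.
rewrite (card_pgroup (pgroupS (Ohm_sub 1 S) pS)).
by rewrite -rank_abelian_pgroup // rankS2.
Qed.

Let PhiN x : x \in S -> x \in 'N('Phi(S)).
Proof. exact: (subsetP (gFnorm _ _)). Qed.

(** In the elementary abelian quotient [S / 'Phi(S)] the image of [x] is non-trivial, hence of order
    [p]. *)
Lemma card_frattini_line x :
  x \in S :\: 'Phi(S) -> #|frattini_line x| = (p * #|'Phi(S)|)%N.
Proof.
case/setDP=> Sx Phix; have nPhix := PhiN Sx.
have nPhi : <[x]> \subset 'N('Phi(S)) by rewrite cycle_subG.
rewrite -(Lagrange (joing_subr <[x]> 'Phi(S))) mulnC -card_quotient; last first.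
  by rewrite join_subG nPhi normG.
rewrite /= quotientYidr // quotient_cycle // -orderE.
rewrite (abelem_order_p (Phi_quotient_abelem pS)) ?mem_quotient //.
by apply: contraNneq Phix => /(coset_idr nPhix).
Qed.

Let line_mem x : x \in frattini_line x.
Proof. exact: (subsetP (joing_subl _ _)) (cycle_id x). Qed.

Let line_sub x : x \in S -> frattini_line x \subset S.
Proof. by move=> Sx; rewrite join_subG cycle_subG Sx Phi_sub. Qed.

Lemma eq_frattini_line x y : x \in S :\: 'Phi(S) -> y \in S :\: 'Phi(S) ->
  (frattini_line x == frattini_line y) = (y \in frattini_line x).
Proof.
move=> Wx Wy; apply/eqP/idP => [-> //|yx]; apply/esym/eqP.
rewrite eqEcard !card_frattini_line // leqnn andbT.
by rewrite join_subG cycle_subG yx joing_subr.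
Qed.

(** The fibre is the line of [x] with ['Phi(S)] removed. *)
Lemma frattini_line_fibre x : x \in S :\: 'Phi(S) ->
  #|[set y in S :\: 'Phi(S) | frattini_line x == frattini_line y]|
    = (p.-1 * #|'Phi(S)|)%N.
Proof.
move=> Wx; have sPhi : 'Phi(S) \subset frattini_line x by apply: joing_subr.
have -> : [set y in S :\: 'Phi(S) | frattini_line x == frattini_line y]
    = frattini_line x :\: 'Phi(S).
  apply/setP => y; rewrite inE; have [Wy|] := boolP (y \in S :\: 'Phi(S)).
    by rewrite eq_frattini_line // [RHS]inE; case/setDP: Wy => _ ->.
  rewrite !inE negb_and negbK => /orP[-> //|Sy] /=.
  apply/esym/negbTE; rewrite negb_and; apply/orP; right.
  apply: contra Sy; apply: (subsetP (line_sub _)).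
  by case/setDP: Wx.
rewrite cardsD (setIidPr sPhi) card_frattini_line //.
by rewrite -{2}[#|'Phi(S)|]mul1n -mulnBl subn1.
Qed.

Lemma card_rank2_setD_Phi :
  #|S :\: 'Phi(S)| = (p.+1 * (p.-1 * #|'Phi(S)|))%N.
Proof.
rewrite cardsD (setIidPr (Phi_sub S)) -card_Phi_rank2 mulnA.
rewrite -{2}[#|'Phi(S)|]mul1n -mulnBl; congr (_ * _)%N.
by rewrite -[X in (_ - X)%N](exp1n 2) subn_sqr subn1 addn1 mulnC.
Qed.

(** A generator inside ['Phi(S)] could be dropped, making [S] cyclic, and two elements of one line
    generate at most that line, which is proper. *)
Lemma rank2_gen2E x y : x \in S -> y \in S -> (<<[set x; y]>> == S) =
  [&& x \in S :\: 'Phi(S), y \in S :\: 'Phi(S)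
    & frattini_line x != frattini_line y].
Proof.
move=> Sx Sy.
have sxyS : <<[set x; y]>> \subset S.
  by rewrite gen_subG subUset !sub1set Sx Sy.
have Phi_notgen a b : a \in 'Phi(S) -> <<[set a; b]>> = S -> False.
  move=> Phia defS; suff : ('r(S) <= 1)%N by rewrite rankS2.
  rewrite -abelian_rank1_cyclic //; apply/cyclicP; exists b.
  apply/esym/Phi_nongen/eqP; rewrite eqEsubset join_subG Phi_sub sub1set.
  have Sb : b \in S by rewrite -defS mem_gen // !inE eqxx orbT.
  rewrite Sb -{1}defS gen_subG subUset !sub1set.
  rewrite (subsetP (joing_subl _ _)) // (subsetP (joing_subr _ _)) //.
  exact: set11.
apply/eqP/and3P => [defS|[Wx Wy xy]].
  have Wx : x \in S :\: 'Phi(S).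
    by apply/setDP; split=> //; apply/negP => /Phi_notgen/(_ defS).
  have Wy : y \in S :\: 'Phi(S).
    apply/setDP; split=> //; apply/negP => Phiy.
    by apply: (Phi_notgen y x Phiy); rewrite setUC.
  split=> //; rewrite eq_frattini_line //; apply/negP => yx.
  have : (#|S| <= #|frattini_line x|)%N.
    apply: subset_leq_card; rewrite -{1}defS gen_subG subUset !sub1set yx.
    by rewrite line_mem.
  rewrite card_frattini_line // -card_Phi_rank2 leq_pmul2r ?cardG_gt0 //.
  by rewrite leqNgt -{1}[p]expn1 ltn_exp2l ?prime_gt1.
have sL := line_sub Sx.
(* Conversely, a line has index [p] and so is maximal: if [x], [y] and ['Phi(S)] do not generate
   [S], they generate the line of [x], which then contains [y]. *)
have maxL : maximal (frattini_line x) S.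
  apply: (p_index_maximal sL).
  rewrite -divgS // card_frattini_line // -card_Phi_rank2 expnS expn1 -mulnA.
  by rewrite mulnK // muln_gt0 prime_gt0 ?cardG_gt0.
apply: Phi_nongen; apply/eqP; rewrite eqEsubset join_subG Phi_sub.
rewrite subUset !sub1set Sx Sy /=; apply: contraNT xy => nS.
rewrite eq_frattini_line //; case/maxgroupP: maxL => _ maxL.
suff <- : 'Phi(S) <*> [set x; y] = frattini_line x.
  by rewrite mem_gen // !inE eqxx !orbT.
apply: (maxL ('Phi(S) <*> [set x; y])%G).
- by rewrite properE nS join_subG Phi_sub subUset !sub1set Sx Sy.
- rewrite join_subG joing_subl cycle_subG andbT.
  by rewrite mem_gen // !inE eqxx !orbT.
Qed.

End FrattiniLines.

(** * Sylow constituents as coordinates *)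

Section SylowCoordinates.

Local Open Scope group_scope.

Variables (k : nat) (p : 'I_k -> nat) (gT : finGroupType) (G : {group gT}).
Variable S : 'I_k -> {group gT}.
Hypothesis p_inj : injective p.
Hypotheses (cGG : abelian G) (defG : \big[dprod/1]_(i < k) S i = G).
Hypothesis sylS : forall i, (p i).-Sylow(G) (S i).

Let SG i : S i \subset G. Proof. exact: pHall_sub (sylS i). Qed.

Let memS i x : x \in G -> (x \in S i) = (p i).-elt x.
Proof.
by apply: mem_normal_Hall => //; rewrite -(sub_abelian_normal _ cGG).
Qed.

Lemma constt_Sylow i x : x \in G -> x.`_(p i) \in S i.
Proof. by move=> Gx; rewrite memS ?groupX // p_elt_constt. Qed.

Lemma constt_prod_Sylow (f : 'I_k -> gT) i :
  (forall j, f j \in S j) -> (\prod_j f j).`_(p i) = f i.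
Proof.
move=> Sf; have Gf j : f j \in G by apply: subsetP (Sf j).
have fi j : (f j).`_(p i) = if j == i then f i else 1.
  case: eqVneq => [->|ji]; first by rewrite constt_p_elt // -memS.
  apply/constt1P; have := Sf j; rewrite memS //; apply: sub_p_elt => r.
  by rewrite !inE => /eqP->; rewrite (inj_eq p_inj).
have: (\prod_j f j).`_(p i) = \prod_j (f j).`_(p i).
  (* Membership in [G] is carried through the induction because [consttM] asks for commuting
     factors. *)
  suff: (\prod_j f j \in G) && ((\prod_j f j).`_(p i) == \prod_j (f j).`_(p i)).
    by case/andP=> _ /eqP.
  elim/big_rec2: _ => [|j a b _ /andP[Gb /eqP ba]].
    by rewrite group1 constt1 eqxx.
  by rewrite groupM // consttM ?ba ?eqxx //; apply: (centsP cGG).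
move=> ->; under eq_bigr do rewrite fi.
by rewrite -big_mkcond big_pred1_eq.
Qed.

Lemma prod_constt_Sylow x : x \in G -> \prod_j x.`_(p j) = x.
Proof.
move=> Gx; have [f [Sf xf _]] := mem_bigdprod defG Gx.
rewrite {2}xf; apply: eq_bigr => i _; rewrite xf constt_prod_Sylow // => j.
exact: Sf.
Qed.

(** Taking constituents is a bijection from [G] onto the families with [i]-th member in [S i]; its
    inverse is the product. *)
Lemma sum_Sylow_coord (R : comPzSemiRingType) (g : 'I_k -> gT -> R) :
  (\sum_(x in G) \prod_i g i x.`_(p i) = \prod_i \sum_(z in S i) g i z)%R.
Proof.
rewrite bigA_distr_big_dep.
rewrite (reindex_onto (fun f : {ffun 'I_k -> gT} => (\prod_i f i)%g)
                      (fun x => [ffun i => x.`_(p i)])) /=; last first.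
  by move=> x Gx; under eq_bigr do rewrite ffunE; apply: prod_constt_Sylow.
apply: eq_big => [f|f /andP[Gf /eqP fE]]; last first.
  by apply: eq_bigr => i _; rewrite -[in RHS]fE ffunE.
apply/andP/familyP => [[Gf /eqP fE] i|Sf].
  by rewrite -fE ffunE constt_Sylow.
split; last by apply/eqP/ffunP => i; rewrite ffunE constt_prod_Sylow.
by apply: group_prod => i _; apply: (subsetP (SG i)); apply: Sf.
Qed.

Lemma gen2_Sylow x y : x \in G -> y \in G ->
  (<<[set x; y]>> == G) = [forall i, <<[set x.`_(p i); y.`_(p i)]>> == S i].
Proof.
move=> Gx Gy; have sHG : <<[set x; y]>> \subset G.
  by rewrite gen_subG subUset !sub1set Gx Gy.
apply/eqP/forallP => [defH i|defS].
  rewrite eqEsubset gen_subG subUset !sub1set !constt_Sylow //=.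
  apply/subsetP => z Sz; have : z \in G by apply: subsetP Sz.
  (* By commutativity [z] is a power of [x] times a power of [y]; being its own [p i]-constituent,
     it is a product of powers of their constituents. *)
  have cyx : <[y]> \subset 'C(<[x]>).
    by rewrite cent_cycle cycle_subG; apply/cent1P/(centsP cGG).
  rewrite -defH -[<<_>>]/([set x] <*> [set y]) -joing_idl -joing_idr.
  rewrite cent_joinEr //.
  case/mulsgP => _ _ /cycleP[a ->] /cycleP[b ->] zE.
  have <- : z.`_(p i) = z.
    by apply: constt_p_elt; rewrite -memS //; apply: subsetP Sz.
  rewrite zE consttM; last by apply/commuteX2/(centsP cGG).
  by rewrite !consttX groupM // groupX // mem_gen // !inE eqxx ?orbT.
(* Constituents are powers, so the group generated by [x] and [y] contains every [S i]. *)
apply/eqP; rewrite eqEsubset sHG -{1}(bigdprodWY defG) gen_subG.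
apply/bigcupsP => i _; rewrite -(eqP (defS i)) gen_subG subUset !sub1set.
by rewrite !groupX // mem_gen // !inE eqxx ?orbT.
Qed.

End SylowCoordinates.
(** * Arithmetic of distinct primes *)

Lemma coprime_bigprod (I : Type) (s : seq I) (P : pred I) (F : I -> nat) n :
  (forall i, P i -> coprime n (F i)) -> coprime n (\prod_(i <- s | P i) F i).
Proof.
move=> nF; elim/big_ind: _ => [|a b na nb|//]; first exact: coprimen1.
by rewrite coprimeMr na.
Qed.

Lemma totient_prod (I : finType) (F : I -> nat) :
  (forall i j, i != j -> coprime (F i) (F j)) ->
  totient (\prod_i F i) = (\prod_i totient (F i))%N.
Proof.
move=> coF; have := index_enum_uniq I.
elim: (index_enum I) => [|i s IH] /=; first by rewrite !big_nil.
case/andP=> is_ us; rewrite !big_cons totient_coprime ?IH //.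
rewrite big_seq; apply: coprime_bigprod => j js; apply: coF.
by apply: contraNneq is_ => ->.
Qed.

(** The divisors of [r * n] are those of [n] and their multiples by [r], two disjoint lists as [r]
    does not divide [n]. *)
Lemma sigma_mul_prime r n : prime r -> (0 < n)%N -> coprime r n ->
  sigma (r * n) = (r.+1 * sigma n)%N.
Proof.
move=> r_pr n_gt0 co_rn; have r_gt0 := prime_gt0 r_pr.
have rn_gt0 : (0 < r * n)%N by rewrite muln_gt0 r_gt0.
have divE : perm_eq (divisors (r * n))
                    (divisors n ++ [seq r * x | x <- divisors n]%N).
  apply: uniq_perm; first exact: divisors_uniq.
    rewrite cat_uniq divisors_uniq map_inj_uniq ?divisors_uniq ?andbT /=.
      apply/hasPn => _ /mapP[x _ ->] /=; rewrite -dvdn_divisors //.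
      apply/negP => /(dvdn_trans (dvdn_mulr x (dvdnn r))).
      by apply/negP; rewrite -prime_coprime.
    by move=> x y /eqP; rewrite eqn_pmul2l // => /eqP.
  move=> x; rewrite -dvdn_divisors // mem_cat -dvdn_divisors //.
  apply/idP/orP => [xrn|[xn|/mapP[y + ->]]].
  - have [rx|nrx] := boolP (r %| x)%N; last first.
      by left; rewrite -(@Gauss_dvdr x r) // coprime_sym prime_coprime.
    case/dvdnP: rx xrn => y ->; rewrite mulnC dvdn_pmul2l // => yn.
    by right; apply: map_f; rewrite -dvdn_divisors.
  - exact: dvdn_mull.
  - by rewrite -dvdn_divisors // dvdn_pmul2l.
rewrite /sigma (perm_big _ divE) big_cat big_map -big_distrr /=.
by rewrite mulSn.
Qed.

Section DistinctPrimes.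

Variables (I : finType) (p : I -> nat).
Hypotheses (p_pr : forall i, prime (p i)) (p_inj : injective p).

Let p_co i j : i != j -> coprime (p i) (p j).
Proof. by move=> ij; rewrite prime_coprime // dvdn_prime2 ?(inj_eq p_inj). Qed.

Lemma sigma_prod_primes : sigma (\prod_i p i) = (\prod_i (p i).+1)%N.
Proof.
have := index_enum_uniq I.
elim: (index_enum I) => [|i s IH] /=.
  by rewrite !big_nil /sigma big_seq1.
case/andP=> is_ us; rewrite !big_cons sigma_mul_prime ?IH //.
  by apply: prodn_gt0 => j; apply: prime_gt0.
rewrite big_seq; apply: coprime_bigprod => j js; apply: p_co.
by apply: contraNneq is_ => ->.
Qed.

Lemma prime_dvd_subset_prod (A : {set I}) i :
  (p i %| \prod_(j in A) p j)%N = (i \in A).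
Proof.
have [iA|iA] := boolP (i \in A); first by rewrite (bigD1 i) //= dvdn_mulr.
apply/negbTE; rewrite -prime_coprime //; apply: coprime_bigprod => j jA.
by apply: p_co; apply: contraNneq iA => ->.
Qed.

(** The primes dividing the product recover the subset; this will separate the eigenvalues. *)
Lemma subset_prod_primes_inj :
  injective (fun A : {set I} => \prod_(j in A) p j)%N.
Proof.
by move=> A B AB; apply/setP => i; rewrite -!prime_dvd_subset_prod AB.
Qed.

End DistinctPrimes.

(** * The Laplacian spectrum of the generating graph *)

Lemma spectrum_array_char_poly n (A : 'M[algC]_n) (cols : seq (algC * nat)) :
  uniq [seq z.1 | z <- cols] ->
  char_poly A = \prod_(z <- cols) ('X - z.1%:P) ^+ z.2 ->
  spectrum_array A cols.
Proof.
move=> ucols chA; split=> //; apply: prod_XsubC_eq.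
rewrite big_flatten big_map (eq_bigr (fun z => ('X - z.1%:P) ^+ z.2)).
  2: by move=> z _; rewrite big_nseq iter_mulr_1.
rewrite -chA /spectrum; case: closed_field_poly_normal => s /= chE.
by rewrite [RHS]chE (monicP (char_poly_monic A)) scale1r.
Qed.

Theorem theorem6p5 (k : nat) (p u : 'I_k -> nat) (gT : finGroupType)
    (G : {group gT}) (S : 'I_k -> {group gT}) :
  (0 < k)%N ->
  (forall i, prime (p i)) ->
  injective p ->
  abelian G ->
  \big[dprod/1%g]_(i < k) S i = G ->
  (forall i, ((p i).-Sylow(G) (S i))%g) ->
  (forall i, ~~ cyclic (S i)) ->
  (forall i, #|S i| = (p i ^ u i)%N) ->
  'm(G)%g = 2%N ->
  let d := (\prod_(i < k) (p i * totient (p i ^ (u i - 1))))%N in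
  let P := (\prod_(i < k) p i)%N in
  regular (G :\: gen_isolated G) (gen_adj G) d /\
  spectrum_array (laplacian_mx G (gen_adj G))
    ([seq (d%:R - (-1) ^+ #|E| * (totient (#|G| %/ P))%:R
                    * \prod_(j in ~: E) (p j)%:R,
           (\prod_(i in E) p i)%N)
       | E : {set 'I_k} in [pred E | E != set0]]
     ++ [:: (d%:R, (#|G| - #|gen_isolated G| - sigma P)%N);
            (0, (#|gen_isolated G| + 1)%N)]).
Proof.
move=> k_gt0 p_pr p_inj cGG defG sylS ncS cardS mG2 d P.
have SG i : S i \subset G := pHall_sub (sylS i).
have pS i : ((p i).-group (S i))%g := pHall_pgroup (sylS i).
have cSS i : abelian (S i) := abelianS (SG i) cGG.
(* For abelian [G], ['m(G)] is the rank, which bounds that of [S i]; non-cyclicity gives the other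
   bound. *)
have rankS2 i : 'r(S i)%g = 2%N.
  apply/eqP; rewrite eqn_leq ltnNge -abelian_rank1_cyclic // ncS andbT.
  by rewrite -mG2 grank_abelian // rankS.
pose W i := S i :\: ('Phi(S i))%g.
pose l i := frattini_line (S i).
pose m i := totient (p i ^ (u i - 1)).
pose c i (x : gT) := (x.`_(p i))%g.
have cardPhi i : (p i ^ 2 * #|('Phi(S i))%g| = p i ^ u i)%N.
  by rewrite card_Phi_rank2.
have u_gt1 i : (1 < u i)%N.
  by rewrite -(@dvdn_Pexp2l (p i)) ?prime_gt1 // -cardPhi dvdn_mulr.
(* Here ['Phi(S i)] has order [p i ^ (u i - 2)], and [1 < u i] makes [totient_pfactor]
   applicable. *)
have mE i : m i = ((p i).-1 * #|('Phi(S i))%g|)%N.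
  rewrite /m totient_pfactor ?subn_gt0 //; congr (_ * _)%N.
  apply/eqP; rewrite -(@eqn_pmul2l (p i ^ 2)) ?expn_gt0 ?prime_gt0 //.
  rewrite cardPhi -expnD.
  by case: (u i) (u_gt1 i) => [|[|v]] // _; rewrite subn1.
have m_gt0 i : (0 < m i)%N by rewrite totient_gt0 expn_gt0 prime_gt0.
have sum_coord (g : 'I_k -> gT -> algC) :
    \sum_(x in G) \prod_i g i (c i x) = \prod_i \sum_(z in S i) g i z.
  exact: sum_Sylow_coord.
have coord_inj : {in G &, forall x y, (forall i, c i x = c i y) -> x = y}.
  move=> x y Gx Gy xy; rewrite -(prod_constt_Sylow p_inj cGG defG sylS Gx).
  rewrite -(prod_constt_Sylow p_inj cGG defG sylS Gy).
  by apply: eq_bigr => i _; apply: xy.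
have WS i : W i \subset S i by apply: subsetDl.
have cardW i : #|W i| = ((p i).+1 * m i)%N.
  by rewrite mE (card_rank2_setD_Phi (pS i)).
have card_fibre i :
    {in W i, forall x, #|[set y in W i | l i x == l i y]| = m i}.
  by move=> x Wx; rewrite mE (frattini_line_fibre (pS i)).
have eE : {in G &, forall x y, gen_adj G x y =
    [forall i, [&& c i x \in W i, c i y \in W i & l i (c i x) != l i (c i y)]]}.
  move=> x y Gx Gy; rewrite /gen_adj /= (gen2_Sylow cGG defG sylS) //.
  have genE : [forall i, <<[set c i x; c i y]>>%g == S i] =
    [forall i, [&& c i x \in W i, c i y \in W i & l i (c i x) != l i (c i y)]].
    apply: eq_forallb => i; rewrite (rank2_gen2E (p_pr i)) //.
      exact: (constt_Sylow cGG sylS).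
    exact: (constt_Sylow cGG sylS).
  (* Distinct lines at a single index already force [x != y]; [0 < k] provides the index. *)
  rewrite genE; apply: andb_idl => /forallP/(_ (Ordinal k_gt0))/and3P[_ _].
  by apply: contraNneq => ->.
pose N := [set x in G | [forall i, c i x \in W i]].
have p_gt0 i : (0 < p i)%N by apply: prime_gt0.
have isoE : gen_isolated G = G :\: N.
  exact: (block_product_isolated sum_coord WS m_gt0 p_gt0 cardW card_fibre eE).
have degE := block_product_degree sum_coord WS cardW card_fibre eE.
have NG : N \subset G by apply/subsetP => x; rewrite inE => /andP[].
split.
  (* Degrees in the subgraph induced on [N] agree with those in [G], as every neighbour lies in
     [N]. *)
  move=> x; rewrite isoE setDDr setDv set0U (setIidPr NG) => Nx.
  have Gx : x \in G := subsetP NG x Nx.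
  have <- : degree G (gen_adj G) x = d by rewrite degE // -/N Nx mul1n.
  apply: eq_card => y; rewrite !inE; apply: andb_id2r => /andP[xy gxy].
  apply: andb_idr => Gy; apply/forallP => i.
  have := eE x y Gx Gy; rewrite /gen_adj /= xy gxy => /esym/forallP/(_ i).
  by case/and3P.
have t_prod : totient (#|G| %/ P) = (\prod_i m i)%N.
  have -> : #|G| = (\prod_i p i ^ (u i - 1) * P)%N.
    rewrite -(bigdprod_card defG) -big_split; apply: eq_bigr => i _ /=.
    by rewrite cardS -expnSr subn1 prednK // ltnW.
  rewrite mulnK ?prodn_gt0 // totient_prod // => i j ij.
  rewrite coprimeXl // coprimeXr // prime_coprime // dvdn_prime2 //.
  by rewrite (inj_eq p_inj).
pose lambda (E : {set 'I_k}) : algC :=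
  (-1) ^+ #|E| * (totient (#|G| %/ P))%:R * \prod_(j in ~: E) (p j)%:R.
(* Every index contributes [m i]; those in [E] add a sign, the others a factor [p i]. *)
have lambdaE (E : {set 'I_k}) :
    \prod_i (if i \in E then - (m i)%:R else (p i * m i)%:R) = lambda E.
  rewrite /lambda -prodr_const t_prod natr_prod [X in _ = _ * _ * X]big_mkcond.
  rewrite [X in _ = X * _ * _]big_mkcond -!big_split; apply: eq_bigr => i _ /=.
  rewrite in_setC natrM; case: (i \in E) => /=; first by rewrite mulN1r mulr1.
  by rewrite mul1r mulrC.
have t_gt0 : (0 < totient (#|G| %/ P))%N by rewrite t_prod prodn_gt0.
have normE E : `|lambda E| =
    (totient (#|G| %/ P) * \prod_(j in ~: E) p j)%:R.
  rewrite /lambda -natr_prod -mulrA normrM normrX normrN1 expr1n mul1r.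
  by rewrite -natrM normr_nat.
(* The norm removes the sign, and the remaining product of primes determines the complement of
   [E]. *)
have lambda_inj : injective lambda.
  move=> E E' /(congr1 Num.norm)/eqP; rewrite !normE eqr_nat eqn_pmul2l //.
  by move/eqP/(subset_prod_primes_inj p_pr p_inj)/setC_inj.
have lambda_neq0 E : lambda E != 0.
  by rewrite -normr_eq0 normE pnatr_eq0 -lt0n muln_gt0 t_gt0 prodn_gt0.
have lambda0 : lambda set0 = d%:R.
  by rewrite -lambdaE natr_prod; apply: eq_bigr => i _; rewrite in_set0.
apply: spectrum_array_char_poly.
  rewrite map_cat -map_comp.
  rewrite -[X in X ++ _]/[seq d%:R - lambda E
                         | E <- enum [pred E : {set 'I_k} | E != set0]].
  rewrite cat_uniq map_inj_uniq ?enum_uniq /=; last first.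
    by move=> E E' /subrI/lambda_inj.
  rewrite mem_seq1 -lambda0 lambda_neq0 andbT orbF negb_or.
  rewrite andbT; apply/andP.
  (* If [d - lambda E] were [d], then [lambda E] would be 0; if it were 0, then [E] would be empty
     by injectivity. *)
  split; apply/mapP => -[E]; rewrite mem_enum inE => E0.
    move/eqP; rewrite eq_sym -subr_eq0 addrAC subrr add0r oppr_eq0.
    by rewrite (negPf (lambda_neq0 E)).
  move/eqP; rewrite eq_sym subr_eq0 (inj_eq lambda_inj) eq_sym.
  by rewrite (negPf E0).
have -> := char_poly_block_product
  sum_coord coord_inj WS m_gt0 cardW card_fibre eE.
rewrite big_cat big_image !big_cons big_nil /= mulr1 subr0.
rewrite -/N isoE sigma_prod_primes //.
have -> : (#|G| - #|G :\: N| = #|N|)%N.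
  by rewrite -(cardsID N G) addnK (setIidPr NG).
(* The empty subset gives the eigenvalue [d - d = 0] once; it joins the zeros from the isolated
   vertices, whence the [+ 1]. *)
rewrite (bigD1 set0) //= lambdaE lambda0 subrr subr0 big_set0 expr1.
rewrite addn1 exprS -!mulrA mulrCA; congr (_ * _); last by rewrite mulrCA.
by apply: eq_bigr => E _; rewrite lambdaE.
Qed.
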